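(* For every polyadic compactum $X$ we have $dis(X) \geq \Delta(X)$.
   Context: All spaces are Hausdorff. A compactum (compact Hausdorff space) is called polyadic if it is a continuous image of some power (product of copies, with the product topology) of the one-point compactification of some discrete set. $dis(X)$ denotes the least number of discrete sets required to cover $X$ (a subset of $X$ is discrete if its subspace topology is discrete; it need not be closed in $X$). $\Delta(X)$ denotes the least cardinality of a nonempty open subset of $X$ (for nonempty $X$). *)

(* Defs.v *)
From HB Require Import structures.
From mathcomp Require Import all_boot.
From mathcomp Require Import all_classical topology.

Set Implicit Arguments.
Unset Strict Implicit.
Unset Printing Implicit Defensive.

Local Open Scope classical_set_scope.
Local Open Scope card_scope.

(* There is no type of cardinal numbers in the library: the least cardinality  *)
(* of a member of [F] is represented by a member of [F] that realizes it.  The *)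
(* value is meaningful only if [F] is nonempty (see [least_cardP]), and is     *)
(* meant to be compared with other sets through [#<=] only.                    *)
Definition least_card (T : Type) (F : set (set T)) : set T :=
  get [set A | F A /\ forall B, F B -> A #<= B].

Lemma least_cardP (T : Type) (F : set (set T)) : F !=set0 ->
  F (least_card F) /\ forall B, F B -> least_card F #<= B.
Proof.
move=> [A0 FA0].
suff h : exists A, F A /\ forall B, F B -> A #<= B by exact: (getPex h).
pose P : set (set (set T -> T)) := [set S |
  (forall g, S g -> forall A, F A -> A (g A)) /\
  (forall g h A, S g -> S h -> F A -> g A = h A -> forall B, F B -> g B = h B)].
have [|S [[Sin Sinj] Smax]] := @Zorn_bigcup _ P.
  move=> C CP Ctot; split=> [g [S CS Sg]|g h A [S CS Sg] [S' CS' S'h] FA e B FB].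
    exact: (CP _ CS).1.
  case: (Ctot _ _ CS CS') => [SS'|S'S].
    by apply: ((CP _ CS').2 g h A) => //; exact: SS'.
  by apply: ((CP _ CS).2 g h A) => //; exact: S'S.
have [A [FA Afull]] :
    exists A, F A /\ forall a, A a -> exists g, S g /\ g A = a.
  apply: contrapT => noA.
  have miss A : exists a, F A -> A a /\ forall g, S g -> g A <> a.
    have [FA|nFA] := pselect (F A); last first.
      have : exists a, A0 a.
        apply: contrapT => A0e; apply: noA; exists A0; split=> // a A0a.
        by case: A0e; exists a.
      by case=> a _; exists a.
    apply: contrapT => nA; apply: noA; exists A; split=> // a Aa.
    apply: contrapT => na; apply: nA; exists a => _; split=> // g Sg ga.
    by apply: na; exists g.
  have [k kP] := choice miss.
  apply: (Smax (S `|` [set k])).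
    split=> [g Sg|/(_ k (or_intror erefl)) Sk]; first by left.
    by case: (kP _ FA0) => _ H; case: (H k Sk).
  split=> [g [/Sin//|-> A FA]|g h A [Sg|->] [Sh|->] FA e B FB].
  - by have [] := kP _ FA.
  - exact: (Sinj g h A).
  - by case: (kP _ FA) => _ H; case: (H g Sg).
  - by case: (kP _ FA) => _ H; case: (H h Sh).
  - by [].
exists A; split=> // B FB.
have sel a : exists g, A a -> S g /\ g A = a.
  have [/Afull[g Sg]|nAa] := pselect (A a); first by exists g.
  by exists (fun=> a) => /nAa.
have [s sP] := choice sel.
have sB : set_fun A B (fun a => s a B).
  by move=> a /sP[Ssa _]; apply: (Sin _ Ssa B FB).
have sI : set_inj A (fun a => s a B).
  move=> a b /set_mem Aa /set_mem Ab e.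
  have [Sa ea] := sP _ Aa; have [Sb eb] := sP _ Ab.
  by rewrite -ea -eb; exact: (Sinj _ _ B Sa Sb FB e A FA).
have <- : ([set s a B | a in A] #<= B) = (A #<= B).
  by rewrite (card_le_eql (inj_card_eq sI)).
by apply: subset_card_le => _ [a Aa <-]; exact: sB.
Qed.

(* [set_type D] carries the subspace topology. *)
Definition discrete_set (X : topologicalType) (D : set X) : Prop :=
  forall B : set (set_type D), open B.

Definition discrete_cover (X : topologicalType) (C : set (set X)) : Prop :=
  (forall D, C D -> discrete_set D) /\ \bigcup_(D in C) D = [set: X].

(* A discrete cover of least cardinality. *)
Definition dis (X : topologicalType) : set (set X) :=
  least_card [set C : set (set X) | discrete_cover C].
Arguments dis : clear implicits.

(* A nonempty open set of least cardinality, for nonempty [X]. *)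
Definition Delta (X : topologicalType) : set X :=
  least_card [set U : set X | open U /\ U !=set0].
Arguments Delta : clear implicits.

Definition polyadic (X : topologicalType) : Prop :=
  [/\ compact [set: X], hausdorff_space X &
      exists (D : discreteTopologicalType) (I : Type)
        (f : {ptws I -> one_point_compactification D} -> X),
        continuous f /\ range f = [set: X]].

Lemma disP (X : topologicalType) : discrete_cover (dis X) /\
  forall C : set (set X), discrete_cover C -> dis X #<= C.
Proof.
apply: least_cardP; exists (range set1); split=> [_ [x _ <-] B|].
  rewrite openE => y By; suff -> : B = setT by exact: filterT.
  apply/seteqP; split=> // z _; suff -> : z = y by [].
  by apply: val_inj; rewrite (set_mem (valP z)) (set_mem (valP y)).
by apply/seteqP; split=> // x _; exists [set x] => //; exists x.
Qed.

Lemma DeltaP (X : topologicalType) : [set: X] !=set0 ->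
  [/\ open (Delta X), Delta X !=set0 &
      forall U : set X, open U -> U !=set0 -> Delta X #<= U].
Proof.
move=> X0; have [|[oD D0] Dmin] := @least_cardP X [set U | open U /\ U !=set0].
  by exists setT; split=> //; exact: openT.
by split=> // U oU U0; exact: Dmin.
Qed.

Lemma polyadic_nonempty (X : topologicalType) : polyadic X -> [set: X] !=set0.
Proof. by case=> _ _ [D [I [f _]]]; exists (f (fun=> None)). Qed.

(* Main.v *)
Require Import Defs.
From mathcomp Require Import all_boot.
From mathcomp Require Import all_classical topology.

(** Let C be a discrete cover of X of cardinality kappa.  If X has an isolated
    point, its singleton is an open set of size 1.  Otherwise C is infinite
    (a finite union of discrete sets has empty interior in a crowded Hausdorff
    space), and the claim is that some nonempty open subset of X has at most
    kappa points.  Write X as the image under f of the power Y = A(D)^I, where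
    A(D) is D together with a point at infinity.  A literal (i, d, e) says that
    the coordinate y i is equal to d, or (if e is false) different from d; a
    box is the set of points satisfying a set of literals.  The boxes of finite
    sets of literals form a base of Y.

    Every nonempty box given by at most kappa literals contains a nonempty box
    given by at most kappa literals on which f is constant (box_constant).  Otherwise, the
    members of C can be avoided one after the other: f is not constant on the
    current box, so finitely many further literals lead first into a set that
    meets the discrete set E in a single value of f, and then away from that
    value.  As a contradiction between literals only involves two of them, all
    members of C would finally be avoided at once by a nonempty box.

    Choose a closed Y1 in Y on which f is irreducible onto X.  Two cases arise,
    according to the sets of values in D that a coordinate takes on the part of
    Y1 above a nonempty open subset of X.

    If for some nonempty open V all these sets have size at most kappa
    (card_le_few_values), close off a set S of kappa literals under them and
    under the boxes of constancy above.  Were a point of V outside the image of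
    the subcube supported by S, a finite box around one of its preimages in Y1
    would miss that subcube.  But the part of the box visible in S contains a
    box of constancy given by literals of S, and each literal of the
    finite box outside S either concerns a coordinate that S leaves free or
    excludes a value that does not occur in S; so f takes a common value on the
    finite box and on the subcube.  Hence V is covered by the image of the
    subcube.  The subcube has a base of size at most kappa, so each discrete set
    meets V in at most kappa points, and V has at most kappa points.

    If over every nonempty open set some coordinate takes more than kappa
    values (exists_few_values refutes this), then inside any finite box meeting
    Y1 there are more than kappa boxes whose images contain pairwise
    disjoint nonempty open sets, by irreducibility; so one can shrink a finite
    box to avoid any given set of at most kappa points of X (box_avoid).  For a
    finite set s of literals, the points x = f z with z of countable support in
    the box of s, such that s supplies all the equalities needed to isolate x
    in its member of C, are at most kappa in number (card_le_stuck).  Avoid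
    these points at each of omega stages.  The point z whose non-infinite
    coordinates are those decided along the way has countable support, and
    finitely many of its coordinates together with finitely many exclusions
    isolate f z in its member of C; at the stage where these coordinates are
    all decided, f z should have been avoided. *)

Local Open Scope classical_set_scope.
Local Open Scope card_scope.

Set Implicit Arguments.
Unset Strict Implicit.

(** * Comparison of cardinalities, and the square of an infinite set *)

(** Comparison through a coding relation, which spares the choice of a function
    and of a default value when the codomain is not known to be inhabited. *)
Lemma code_card_le (T U : Type) (A : set T) (B : set U) (R : T -> U -> Prop) :
  (forall x, A x -> exists2 y, B y & R x y) ->
  (forall x x' y, A x -> A x' -> R x y -> R x' y -> x = x') -> A #<= B.
Proof.
move=> tot inj; have [->|/set0P[a Aa]] := eqVneq A set0; first exact: card_ge0.
have [b _ _] := tot _ Aa.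
have /choice[g gP] : forall x, exists y, A x -> B y /\ R x y.
  move=> x; have [/tot[y]|nAx] := pselect (A x); first by exists y.
  by exists b.
suff [f] : $|{injfun A >-> B}| by exact: inj_card_le.
apply/injfunPex; exists g; first by move=> x /gP[].
move=> x y /set_mem Ax /set_mem Ay e.
have [Bgx Rx] := gP _ Ax; have [_ Ry] := gP _ Ay.
by apply: (inj _ _ (g x)) => //; rewrite e.
Qed.

Lemma card_le_fun (T U : Type) (A : set T) (B : set U) : A #<= B ->
  U -> exists g : T -> U, (forall x, A x -> B (g x)) /\
    (forall x y, A x -> A y -> g x = g y -> x = y).
Proof.
move=> /card_leP[f] u.
pose g x := if pselect (A x) is left Ax then val (f (SigSub (mem_set Ax))) else u.
exists g; split=> [x Ax|x y Ax Ay].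
  by rewrite /g; case: pselect => // Ax'; exact: set_mem (valP _).
rewrite /g; case: pselect => // Ax'; case: pselect => // Ay' /val_inj e.
by have /(congr1 val) := inj (mem_set I) (mem_set I) e.
Qed.

(** [least_cardP] applied to copies of the two sets in the sum type. *)
Lemma card_le_total (T U : Type) (A : set T) (B : set U) : A #<= B \/ B #<= A.
Proof.
pose A' := inl @` A : set (T + U); pose B' := inr @` B : set (T + U).
have A'A : A' #= A by apply: inj_card_eq => x y _ _ [].
have B'B : B' #= B by apply: inj_card_eq => x y _ _ [].
have [|h hmin] := @least_cardP _ [set A'; B']; first by exists A'; left.
rewrite -(card_le_eql A'A) -(card_le_eqr B'B) -(card_le_eql B'B) -(card_le_eqr A'A).
by case: h => e; rewrite e in hmin; [left|right]; apply: hmin; [right|left].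
Qed.

(** A partial pairing function is encoded as a ternary relation, so that chains
    of pairing functions have their union as an upper bound; its domain is the
    square of the field below. *)
Definition pairing_field (T : Type) (G : set (T * T * T)) : set T :=
  [set x | exists y z, G (x, y, z)].

Definition is_pairing (T : Type) (G : set (T * T * T)) : Prop :=
  [/\ forall x y, pairing_field G x -> pairing_field G y -> exists z, G (x, y, z),
      forall x y z, G (x, y, z) -> pairing_field G y /\ pairing_field G z,
      forall x y z z', G (x, y, z) -> G (x, y, z') -> z = z' &
      forall x y x' y' z, G (x, y, z) -> G (x', y', z) -> x = x' /\ y = y'].

Lemma pairing_bigcup (T : Type) (F : set (set (T * T * T))) :
  F `<=` @is_pairing T -> total_on F subset -> is_pairing (\bigcup_(G in F) G).
Proof.
move=> FP Ftot.
have join u v : (\bigcup_(G in F) G) u -> (\bigcup_(G in F) G) v ->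
    exists G, [/\ F G, G u & G v].
  move=> [G FG Gu] [H FH Hv].
  by case: (Ftot _ _ FG FH) => S; [exists H|exists G]; split=> //; exact: S.
have fld G x : F G -> pairing_field G x -> pairing_field (\bigcup_(G in F) G) x.
  by move=> FG [y [z Gz]]; exists y, z, G.
split.
- move=> x y [x1 [x2 Gx]] [y1 [y2 Gy]].
  have [G [FG Gx' Gy']] := join _ _ Gx Gy.
  have [+ _ _ _] := FP _ FG.
  move=> /(_ x y)[||z Gz]; [by exists x1, x2|by exists y1, y2|].
  by exists z, G.
- move=> x y z [G FG Gz]; have [_ /(_ _ _ _ Gz)[gy gz] _ _] := FP _ FG.
  by split; apply: (fld G).
- move=> x y z z' Gz Gz'; have [G [FG Hz Hz']] := join _ _ Gz Gz'.
  by have [_ _ H _] := FP _ FG; apply: H Hz Hz'.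
- move=> x y x' y' z Gz Gz'; have [G [FG Hz Hz']] := join _ _ Gz Gz'.
  by have [_ _ _ H] := FP _ FG; apply: H Hz Hz'.
Qed.

Lemma pairing_fun (T : Type) (t : T) (G : set (T * T * T)) : is_pairing G ->
  exists j : T -> T -> T, let A := pairing_field G in
  [/\ forall x y, A x -> A y -> G (x, y, j x y),
      forall x y, A x -> A y -> A (j x y) &
      forall x y x' y', A x -> A y -> A x' -> A y' -> j x y = j x' y' ->
        x = x' /\ y = y'].
Proof.
case=> tot cl _ inj.
have /choice[j jP] : forall p : T * T, exists z,
    pairing_field G p.1 -> pairing_field G p.2 -> G (p.1, p.2, z).
  case=> x y /=; have [Ax|nAx] := pselect (pairing_field G x); last by exists t.
  have [Ay|nAy] := pselect (pairing_field G y); last by exists t.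
  by have [z Gz] := tot _ _ Ax Ay; exists z.
exists (fun x y => j (x, y)) => /=; split=> [x y Ax Ay|x y Ax Ay|x y x' y' Ax Ay Ax' Ay' e].
- exact: (jP (x, y)).
- by have [] := cl _ _ _ (jP (x, y) Ax Ay).
- by apply: (inj _ _ _ _ _ (jP (x, y) Ax Ay)); rewrite /= e; exact: (jP (x', y')).
Qed.

Lemma pairing_nat (T : Type) : [set: nat] #<= [set: T] ->
  exists G : set (T * T * T), is_pairing G /\
    exists a b, [/\ pairing_field G a, pairing_field G b & a <> b].
Proof.
move=> NT; have [t] : $|T|.
  by case/card_leP: (NT) => f; squash (val (f (SigSub (mem_set I : 0 \in setT)))).
have [g [_ ginj]] := card_le_fun NT t.
have {}ginj m n : g m = g n -> m = n by exact: ginj.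
have [k [_ kinj]] : exists k : nat * nat -> nat,
   (forall x, [set: nat * nat] x -> [set: nat] (k x)) /\
   (forall x y, [set: nat * nat] x -> [set: nat * nat] y -> k x = k y -> x = y).
  by apply: (fun h => card_le_fun h 0); have := card_nat2; rewrite card_eq_le => /andP[].
pose G : set (T * T * T) := [set u | exists m n, u = (g m, g n, g (k (m, n)))].
have fld m : pairing_field G (g m) by exists (g 0), (g (k (m, 0))), m, 0.
exists G; split; last first.
  by exists (g 0), (g 1); split=> // /ginj.
split.
- move=> x y [_ [_ [m [_ [-> _ _]]]]] [_ [_ [n [_ [-> _ _]]]]].
  by exists (g (k (m, n))), m, n.
- by move=> x y z [m [n [_ -> ->]]].
- by move=> x y z z' [m [n [-> -> ->]]] [m' [n' [/ginj-> /ginj-> ->]]].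
- move=> x y x' y' z [m [n [-> -> ->]]] [m' [n' [-> ->]]] /ginj/kinj.
  by move=> /(_ I I)[-> ->].
Qed.

(** If the complement of A is at least as large as A, it contains a copy B of A.
    The two distinct points a and b give an injection of A and B together into
    A, hence of the square of their union into A, and thus into B; this defines
    the pairing on the pairs not contained in A, with values away from the old
    ones. *)
Lemma pairing_extend (T : Type) (G : set (T * T * T)) a b :
  is_pairing G -> pairing_field G a -> pairing_field G b -> a <> b ->
  pairing_field G #<= ~` pairing_field G -> exists2 H, is_pairing H & G `<` H.
Proof.
move=> sG Aa Ab nab; set A := pairing_field G => /card_le_fun/(_ a)[h [hA hinj]].
have [j [/= jG jA jinj]] := pairing_fun a sG; rewrite -/A in jG jA jinj.
case: sG => tot cl fn inj; rewrite -/A in tot cl.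
have /choice[c cP] : forall x, exists y, A x /\ y = j a x \/
    (exists2 x', A x' & x = h x' /\ y = j b x') \/ (~ A x /\ ~ (h @` A) x).
  move=> x; have [Ax|nAx] := pselect (A x); first by exists (j a x); left.
  have [[x' Ax' <-]|nBx] := pselect ((h @` A) x).
    by exists (j b x'); right; left; exists x'.
  by exists a; right; right.
pose A' := A `|` h @` A.
have cA x : A' x -> A (c x).
  move=> A'x; case: (cP x) => [[Ax ->]|[[x' Ax' [_ ->]]|[nA nB]]]; try exact: jA.
  by case: A'x.
have cinj x y : A' x -> A' y -> c x = c y -> x = y.
  move=> A'x A'y e.
  case: (cP x) => [[Ax ex]|[[x' Ax' [ex ex']]|[nA nB]]]; last by case: A'x.
    case: (cP y) => [[Ay ey]|[[y' Ay' [ey ey']]|[nA nB]]]; last by case: A'y.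
      by move: e; rewrite ex ey => /jinj[].
    by move: e; rewrite ex ey' => /jinj[].
  case: (cP y) => [[Ay ey]|[[y' Ay' [ey ey']]|[nA nB]]]; last by case: A'y.
    by move: e; rewrite ex' ey => /jinj[] // /esym.
  by move: e; rewrite ex' ey' ex ey => /jinj[]// _ ->.
pose N : set (T * T * T) := [set u | [/\ A' u.1.1, A' u.1.2,
  ~ (A u.1.1 /\ A u.1.2) & u.2 = h (j (c u.1.1) (c u.1.2))]].
pose H := G `|` N.
have Gfld x y z : G (x, y, z) -> [/\ A x, A y & A z].
  by move=> Gz; have [Ay Az] := cl _ _ _ Gz; split=> //; exists y, z.
have NB x y z : N (x, y, z) -> ~ A z /\ (h @` A) z.
  move=> [/= A'x A'y _ ->]; have Aj : A (j (c x) (c y)) by apply: jA; exact: cA.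
  by split; [exact: hA|exists (j (c x) (c y))].
have tot' x y : A' x -> A' y -> exists z, H (x, y, z).
  move=> A'x A'y; have [[Ax Ay]|nA] := pselect (A x /\ A y).
    by exists (j x y); left; exact: jG.
  by exists (h (j (c x) (c y))); right.
have Hfld x : pairing_field H x <-> A' x.
  split=> [[y [z [/Gfld[Ax _ _]|[]//]]]|A'x]; first by left.
  have [z Hz] := tot' x x A'x A'x; by exists x, z.
exists H; first split.
- by move=> x y /Hfld A'x /Hfld A'y; exact: tot'.
- move=> x y z [/Gfld[Ax Ay Az]|Nz]; first by split; apply/Hfld; left.
  split; apply/Hfld; first by case: Nz.
  by right; case: (NB _ _ _ Nz).
- move=> x y z z' [Gz|[/= A'x A'y nA ->]] [Gz'|[/= A'x' A'y' nA' ->]] //.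
  + exact: fn Gz Gz'.
  + by case: nA'; case: (Gfld _ _ _ Gz).
  + by case: nA; case: (Gfld _ _ _ Gz').
- move=> x y x' y' z [Gz|Nz] [Gz'|Nz'].
  + exact: inj Gz Gz'.
  + by case: (NB _ _ _ Nz'); case: (Gfld _ _ _ Gz).
  + by case: (NB _ _ _ Nz); case: (Gfld _ _ _ Gz').
  + move: Nz Nz' => [/= A'x A'y nA ->] [/= A'x' A'y' nA'].
    by move=> /hinj/jinj[]; try exact: cA; try (apply: jA; exact: cA);
      move=> /cinj-> // /cinj->.
split; first by left.
move=> HG; have [z Hz] : exists z, H (a, h a, z).
  by apply: tot'; [left|right; exists a].
by case: (Gfld _ _ _ (HG _ Hz)) => _ + _; exact: hA.
Qed.

(** Zorn's lemma applied to the pairings that extend a fixed one with infinite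
    field.  A maximal pairing has a field A at least as large as its complement,
    by [pairing_extend]; the type then injects into two disjoint copies of A,
    hence into A. *)
Lemma card_le_square_setT (T : Type) : [set: nat] #<= [set: T] ->
  [set: T * T] #<= [set: T].
Proof.
move=> /pairing_nat[G0 [sG0 [a [b [A0a A0b nab]]]]].
pose P : set (set (T * T * T)) := fun G => is_pairing (G0 `|` G).
have [|G [PG Gmax]] := @Zorn_bigcup _ P.
  move=> F FP Ftot; have [->|/set0P[G1 FG1]] := eqVneq F set0.
    by rewrite /P bigcup_set0 setU0.
  have -> : P (\bigcup_(G in F) G) =
      is_pairing (\bigcup_(G in [set G0 `|` G | G in F]) G).
    rewrite /P; congr is_pairing; apply/seteqP; split=> [u [G0u|[G FG Gu]]|u].
    - by exists (G0 `|` G1); [exists G1|left].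
    - by exists (G0 `|` G); [exists G|right].
    - by move=> [_ [G FG <-]] [G0u|Gu]; [left|right; exists G].
  apply: pairing_bigcup => [_ [G FG <-]|_ _ [G FG <-] [H FH <-]].
    exact: FP.
  by case: (Ftot _ _ FG FH) => S; [left|right]; exact: setUS.
pose H := G0 `|` G; pose A := pairing_field H.
have Aa : A a by case: A0a => y [z]; exists y, z; left.
have Ab : A b by case: A0b => y [z]; exists y, z; left.
have [/(pairing_extend PG Aa Ab nab)[K sK [HK nKH]]|] :=
    card_le_total A (~` A).
  exfalso; apply: (Gmax K); last first.
    by rewrite /P; suff -> : G0 `|` K = K by []; apply/setUidPr => u ?; apply: HK; left.
  split=> [u Gu|KG]; first by apply: HK; right.
  by apply: nKH => u /KG; right.
move=> /card_le_fun/(_ a)[h [hA hinj]].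
have [j [/= _ jA jinj]] := pairing_fun a PG; rewrite -/A in jA jinj.
pose c x y := (A x /\ y = j a x) \/ (~ A x /\ y = j b (h x)).
have cT : [set: T] #<= A.
  apply: (@code_card_le _ _ _ _ c) => [x _|x x' y _ _].
    have [Ax|nAx] := pselect (A x); first by exists (j a x); [exact: jA|left].
    by exists (j b (h x)); [apply: jA => //; exact: hA|right].
  move=> [[Ax ->]|[nAx ->]] [[Ax']|[nAx']].
  - by move=> /jinj[].
  - by move=> /jinj[]//; exact: hA.
  - by move=> /jinj[]//; [exact: hA|move=> /esym].
  - by move=> /jinj[]//; try exact: hA; move=> _ /hinj; exact.
have [g [gA ginj]] := card_le_fun cT a.
apply: (@code_card_le _ _ _ _ (fun x y => y = j (g x.1) (g x.2))).
  by move=> x _; exists (j (g x.1) (g x.2)).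
move=> [x1 x2] [y1 y2] _ _ _ /= -> /jinj[]; try exact: gA.
by move=> /ginj-> // /ginj->.
Qed.


Lemma card_le_square (T : Type) (A : set T) : infinite_set A -> A `*` A #<= A.
Proof.
move=> /infiniteP NA.
have NT : [set: nat] #<= [set: A] by rewrite (card_le_eqr (card_setT A)).
have [t] : $|A|.
  by case/card_leP: (NT) => f; squash (val (f (SigSub (mem_set I : 0 \in setT)))).
have [j [_ jinj]] := card_le_fun (card_le_square_setT NT) t.
apply: (@code_card_le _ _ _ _ (fun x y =>
    exists a b : A, x = (val a, val b) /\ y = val (j (a, b)))).
  move=> [x y] [/= Ax Ay].
  exists (val (j (SigSub (mem_set Ax), SigSub (mem_set Ay)))).
    exact: set_mem (valP _).
  by exists (SigSub (mem_set Ax)), (SigSub (mem_set Ay)).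
move=> _ _ y _ _ [a [b [-> ->]]] [a' [b' [->]]] /val_inj /jinj.
by move=> /(_ I I)[-> ->].
Qed.

(** * Sets of at most a given infinite cardinality *)

Section AtMost.
Context {K : Type} (C : set K).
Hypothesis infC : infinite_set C.

Lemma card_le_countable (T : Type) (A : set T) : countable A -> A #<= C.
Proof. by move=> cA; apply: card_le_trans cA _; exact/infiniteP. Qed.

Lemma card_le_bigcup (I T : Type) (D : set I) (F : I -> set T) :
  D #<= C -> (forall i, D i -> F i #<= C) -> \bigcup_(i in D) F i #<= C.
Proof.
move=> DC FC; have [k Ck] := infinite_setN0 infC.
have [g [gC ginj]] := card_le_fun DC k.
have /choice[h hP] : forall i, exists h : T -> K, D i ->
    (forall x, F i x -> C (h x)) /\
    (forall x y, F i x -> F i y -> h x = h y -> x = y).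
  move=> i; have [Di|nDi] := pselect (D i); last by exists (fun=> k).
  by have [h hP] := card_le_fun (FC _ Di) k; exists h.
apply: (card_le_trans _ (card_le_square infC)).
apply: (@code_card_le _ _ _ _
  (fun x y => exists i, [/\ D i, F i x & y = (g i, h i x)])).
  move=> x [i Di Fix]; exists (g i, h i x); last by exists i.
  by split=> /=; [exact: gC|apply: (hP i Di).1].
move=> x x' _ _ _ [i [Di Fix ->]] [i' [Di' Fix' [/ginj e]]].
by move: Fix'; rewrite -(e Di Di') => Fix'; exact: (hP i Di).2.
Qed.

Lemma card_le_setX (T U : Type) (A : set T) (B : set U) :
  A #<= C -> B #<= C -> A `*` B #<= C.
Proof.
move=> AC BC; have -> : A `*` B = A `*`` (fun=> B) by [].
rewrite -bigcupX1l; apply: card_le_bigcup => // x _.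
apply: (card_le_trans _ BC).
apply: (@code_card_le _ _ _ _ (fun p y => p = (x, y))).
  by move=> [_ y] [/= -> By]; exists y.
by move=> p p' y _ _ -> ->.
Qed.

Lemma card_le_setU (T : Type) (A B : set T) :
  A #<= C -> B #<= C -> A `|` B #<= C.
Proof.
move=> AC BC; rewrite -[X in X #<= _]bigcup2E; apply: card_le_bigcup.
  exact: card_le_countable.
by case=> [|[|n]] _ //=; exact: card_ge0.
Qed.

Lemma card_le_seq (T : eqType) (A : set T) :
  A #<= C -> [set s : seq T | forall x, x \in s -> A x] #<= C.
Proof.
move=> AC; pose S n := [set s : seq T | size s = n /\ forall x, x \in s -> A x].
apply: (card_le_trans (subset_card_le (B := \bigcup_n S n) _)).
  by move=> s As; exists (size s).
apply: card_le_bigcup => [|n _]; first exact: card_le_countable.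
elim: n => [|n IHn].
  apply/card_le_countable/finite_set_countable.
  by apply: (sub_finite_set (B := [set [::]])); [move=> [|x s] []|exact: finite_set1].
have -> : S n.+1 = (fun p => p.1 :: p.2) @` (A `*` S n).
  apply/seteqP; split=> [[|x s] [//= [sn] As]|_ [[x s] [/= Ax [sn As]] <-]].
    exists (x, s) => //; split=> /=; first by apply: As; rewrite mem_head.
    by split=> // y ys; apply: As; rewrite in_cons ys orbT.
  by split=> /= [|y]; [rewrite sn|rewrite in_cons => /orP[/eqP->|/As]].
exact: card_le_trans (card_image_le _ _) (card_le_setX AC IHn).
Qed.

(** Closing off under at most |C| operations, each sending finite sequences to
    sets of size at most |C|. *)
Lemma card_le_closure (T : eqType) (J : Type) (B : set J)
    (h : J -> seq T -> set T) :
  B #<= C -> (forall j s, B j -> h j s #<= C) ->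
  exists S : set T, S #<= C /\ forall j s, B j ->
    (forall x, x \in s -> S x) -> h j s `<=` S.
Proof.
move=> BC hC.
pose step S := S `|` \bigcup_(js in B `*` [set s : seq T | forall x, x \in s -> S x])
   h js.1 js.2.
pose Sn n := iter n step set0.
have Sle m n : (m <= n)%N -> Sn m `<=` Sn n.
  elim: n => [|n IHn]; first by rewrite leqn0 => /eqP->.
  rewrite leq_eqVlt => /orP[/eqP->//|]; rewrite ltnS => /IHn mn x /mn Sx.
  by left.
exists (\bigcup_n Sn n); split.
  apply: card_le_bigcup => [|n _]; first exact: card_le_countable.
  elim: n => [|n IHn]; first exact: card_ge0.
  apply: card_le_setU => //; apply: card_le_bigcup => [|[j s] [/= Bj _]].
    by apply: card_le_setX => //; exact: card_le_seq.
  exact: hC.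
move=> j s Bj sS x hx.
have [n sn] : exists n, forall x, x \in s -> Sn n x.
  elim: s sS {x hx} => [|y s IHs] sS; first by exists 0.
  have [|n sn] := IHs; first by move=> x xs; apply: sS; rewrite in_cons xs orbT.
  have [m _ ym] := sS y (mem_head _ _).
  exists (maxn m n) => x; rewrite in_cons => /orP[/eqP->|/sn].
    exact: Sle (leq_maxl m n) _ ym.
  exact: Sle (leq_maxr m n) _.
by exists n.+1 => //; right; exists (j, s).
Qed.

End AtMost.

(** * Boxes in a power of a one-point compactification *)

Section Cube.
Context {D : discreteTopologicalType} {I : eqType}.
Local Notation opc := (one_point_compactification D).
Local Notation Y := {ptws I -> opc}.
Local Notation Lit := (I * D * bool)%type.
Implicit Types (y z : Y) (l : Lit) (q : set Lit) (s : seq Lit).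

(** The literal (i, d, true) stands for y i = Some d, and (i, d, false) for its
    negation. *)
Definition sat y l : bool := (y l.1.1 == Some l.1.2) == l.2.

Definition box q : set Y := [set y | forall l, q l -> sat y l].

Lemma compact_cube : compact [set: Y].
Proof.
have cT (i : I) := @one_point_compactification_compact D.
have := @tychonoff I (fun=> opc) (fun=> setT) cT.
by congr compact; apply/seteqP; split.
Qed.

Lemma open_opc_Some (d : D) : @open opc [set Some d].
Proof.
rewrite -image_set1; apply: one_point_compactification_open_some.
exact: discrete_open.
Qed.

Lemma closed_opc_Some (d : D) : @closed opc [set Some d].
Proof.
rewrite -openC openE => -[d'|] /= nd.
  have dd' : d' <> d by move=> e; apply: nd; rewrite e.
  apply: (filterS (P := Some @` [set d'])).
    by move=> _ [_ -> <-] /= [].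
  apply: one_point_compactification_some_nbhs; exact: discrete_set1.
have : @nbhs _ opc None (~` [set Some d]); last by [].
exists [set d]; first by split; [exact: compact_set1|exact: discrete_closed].
by move=> _ [[d' dd' <-] [e]|->] //; exact: dd'.
Qed.

Lemma sat_clopen l : clopen [set y : Y | sat y l].
Proof.
have E : [set y : Y | y l.1.1 == Some l.1.2] =
    proj l.1.1 @^-1` ([set Some l.1.2] : set opc).
  by apply/seteqP; split=> y /eqP.
have C : clopen [set y : Y | y l.1.1 == Some l.1.2].
  rewrite E; apply: preimage_clopen; last exact: proj_continuous.
  by split; [exact: open_opc_Some|exact: closed_opc_Some].
have [lT|lF] := boolP l.2.
  suff -> : [set y : Y | sat y l] = [set y : Y | y l.1.1 == Some l.1.2] by [].
  by apply/seteqP; split=> y; rewrite /sat /= lT eqb_id.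
suff -> : [set y : Y | sat y l] = ~` [set y : Y | y l.1.1 == Some l.1.2].
  by case: C => oC cC; split; [exact: closed_openC|exact: open_closedC].
apply/seteqP; split=> y; rewrite /sat /= (negbTE lF).
  by move=> /eqP/negbT/negP.
by move=> /negP/negbTE->.
Qed.

Lemma closed_box q : closed (box q).
Proof.
have -> : box q = \bigcap_(l in q) [set y | sat y l] by [].
by apply: closed_bigI => l _; case: (sat_clopen l).
Qed.

Lemma open_box s : open (box [set` s]).
Proof.
have -> : box [set` s] = \bigcap_(l in [set` s]) [set y | sat y l] by [].
elim: s => [|l s IHs].
  suff -> : [set` [::]] = (set0 : set Lit) by rewrite bigcap_set0; exact: openT.
  by apply/seteqP; split.
suff -> : [set` l :: s] = l |` [set` s].
  by rewrite bigcap_setU1; apply: openI => //; case: (sat_clopen l).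
by apply/seteqP; split=> x /=; rewrite in_cons => /predU1P.
Qed.

Lemma compact_discrete_finite (A : set D) : compact A -> finite_set A.
Proof.
rewrite compact_near_coveringP => cA.
pose F : set_system (seq D) :=
  filter_from [set: seq D] (fun u => [set t | {subset u <= t}]).
have FF : Filter F.
  apply: filter_from_filter; first by exists [::].
  move=> u v _ _; exists (u ++ v) => // w uvw.
  by split=> x xs; apply: uvw; rewrite mem_cat xs ?orbT.
have [|u _ /(_ u) uA] := cA _ F (fun t x => x \in t) FF.
  move=> d Ad; exists ([set d], [set t | d \in t]); first split.
  - exact: discrete_set1.
  - by exists [:: d] => // t; apply; rewrite mem_head.
  - by move=> [x t] /= [-> ].
apply: (sub_finite_set _ (finite_seq u)) => d Ad; exact: uA.
Qed.

(** Base of the product topology: a neighbourhood of infinity in the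
    compactification of a discrete space only excludes finitely many points, so
    it is described by finitely many negative literals. *)
Lemma nbhs_box y (W : set Y) : nbhs y W ->
  exists s, box [set` s] y /\ box [set` s] `<=` W.
Proof.
pose F : set_system Y := filter_from [set s | box [set` s] y] (fun s => box [set` s]).
have FF : Filter F.
  apply: filter_from_filter; first by exists [::].
  move=> s t sy ty; exists (s ++ t).
    by move=> l /=; rewrite mem_cat => /orP[/sy|/ty].
  by move=> z st; split=> l ls; apply: st; rewrite /= mem_cat ls ?orbT.
suff Fy : F --> y by move=> /Fy[s sy sW]; exists s.
apply/cvg_sup => i U [V] [[/= O] oO <-] Oy OU.
suff [s sy sO] : F ((fun z => z i) @^-1` O) by exists s => // z /sO; exact: OU.
have := oO; rewrite openE => /(_ _ Oy).
rewrite /interior /=.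
case yi : (y i) => [d|].
  move=> /nbhs_singleton Od.
  exists [:: (i, d, true)].
    by move=> l /=; rewrite inE => /eqP->; rewrite /sat /= yi eqxx.
  move=> z /(_ (i, d, true)); rewrite /= mem_head => /(_ isT).
  by rewrite /sat /= => /eqP/eqP->.
move=> [K [cK _] KO].
have [t tK] := (finite_seqP K).1 (compact_discrete_finite cK).
exists [seq (i, d, false) | d <- t].
  by move=> l /= /mapP[d dt ->]; rewrite /sat /= yi.
move=> z zt; apply: KO => /=; case zi : (z i) => [d|]; last by right.
left; exists d => //= Kd; rewrite tK /= in Kd.
have := zt (i, d, false) (map_f (fun d => (i, d, false)) Kd).
by rewrite /sat /= zi eqxx.
Qed.

(** For a set of literals this characterizes the nonemptiness of its box while
    visibly passing to unions of chains. *)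
Definition consistent q : Prop :=
  (forall i d d', q (i, d, true) -> q (i, d', true) -> d = d') /\
  (forall i d, q (i, d, true) -> ~ q (i, d, false)).

Lemma sat_true y i d : sat y (i, d, true) <-> y i = Some d.
Proof. by rewrite /sat /= eqb_id; split=> /eqP. Qed.

Lemma sat_false y i d : sat y (i, d, false) <-> y i <> Some d.
Proof.
rewrite /sat /=; split=> [/eqP/negbT/eqP//|/eqP/negbTE->//].
Qed.

Lemma box_consistent q : box q !=set0 -> consistent q.
Proof.
move=> [y qy]; split=> [i d d' /qy/sat_true yd /qy/sat_true|].
  by rewrite yd => -[].
by move=> i d /qy/sat_true yd /qy/sat_false.
Qed.

(** The point that is infinite wherever q does not prescribe a value. *)
Lemma consistent_pt q : consistent q ->
  exists2 z, box q z & forall i d, z i = Some d -> q (i, d, true).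
Proof.
move=> [qt qf].
have /choice[z zP] : forall i, exists o : opc,
    (forall d, q (i, d, true) -> o = Some d) /\ (forall d, o = Some d -> q (i, d, true)).
  move=> i; have [[d qd]|nq] := pselect (exists d, q (i, d, true)).
    by exists (Some d); split=> [d' /(qt _ _ _ qd)->|d' [<-]].
  by exists None; split=> // d qd; case: nq; exists d.
exists z => [[[i d] [|]] ql|i d]; [| |exact: (zP i).2].
  by apply/sat_true; exact: (zP i).1.
by apply/sat_false => /(zP i).2 /qf.
Qed.

Lemma sub_box p q : p `<=` q -> box q `<=` (box p : set Y).
Proof. by move=> pq y qy l /pq/qy. Qed.

Lemma boxU p q : box (p `|` q) = box p `&` (box q : set Y).
Proof.
apply/seteqP; split=> [y pqy|y [py qy] l [/py|/qy]//].
by split=> l ql; apply: pqy; [left|right].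
Qed.

End Cube.

(** * Discrete sets and chains of open sets *)

Lemma discrete_set_isolated (X : topologicalType) (E : set X) (x : X) :
  discrete_set E -> E x ->
  exists U : set X, [/\ open U, U x & forall y, U y -> E y -> y = x].
Proof.
move=> dE Ex; pose x' : E := SigSub (mem_set Ex).
have [U oU Ux] := dE [set x'].
exists U; split=> //.
  by have : [set x'] x' by []; rewrite -Ux.
move=> y Uy Ey; have : [set x'] (SigSub (mem_set Ey)) by rewrite -Ux.
by move=> /(congr1 val).
Qed.

Lemma compact_chain_cover (T : topologicalType) (K : set T) (F : set (set T)) :
  compact K -> F !=set0 -> total_on F subset -> (forall W, F W -> open W) ->
  K `<=` \bigcup_(W in F) W -> exists2 W, F W & K `<=` W.
Proof.
rewrite compact_near_coveringP => cK [W0 FW0] Ftot Fo KF.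
pose G : set_system (set T) :=
  filter_from F (fun W => [set V | F V /\ W `<=` V]).
have FG : Filter G.
  apply: filter_from_filter; first by exists W0.
  move=> W V FW FV; case: (Ftot _ _ FW FV) => S; [exists V|exists W] => //.
    by move=> Z [FZ VZ]; split; split=> //; exact: subset_trans VZ.
  by move=> Z [FZ VZ]; split; split=> //; exact: subset_trans VZ.
have [|W FW WK] := cK _ G (fun W x => W x) FG.
  move=> x /KF[W FW Wx]; exists (W, [set V | F V /\ W `<=` V]).
    split=> /=; first by apply: open_nbhs_nbhs; split=> //; exact: Fo.
    by exists W.
  by move=> [y V] [/= Wy [_]]; exact.
exists W => //; exact: (WK W (conj FW (@subset_refl _ W))).
Qed.

(** * Continuous images of a power of a one-point compactification *)

Section Image.
Context {D : discreteTopologicalType} {I : eqType} {X : topologicalType}.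
Local Notation opc := (one_point_compactification D).
Local Notation Y := {ptws I -> opc}.
Local Notation Lit := (I * D * bool)%type.
Variable f : Y -> X.
Hypotheses (hX : hausdorff_space X) (cf : continuous f).
Hypothesis fY : forall x, exists y, f y = x.
Implicit Types (x : X) (y z : Y) (l : Lit) (p q : set Lit) (s : seq Lit).

Lemma closed_image (K : set Y) : closed K -> closed (f @` K).
Proof.
move=> cK; apply: compact_closed => //.
apply: continuous_compact; first by apply: continuous_subspaceT => y; exact: cf.
exact: subclosed_compact cK compact_cube _.
Qed.

Lemma open_box_image (U : set X) y : open U -> U (f y) ->
  exists s, box [set` s] y /\ forall z, box [set` s] z -> U (f z).
Proof.
move=> oU Uy; apply: (@nbhs_box _ _ y (f @^-1` U)).
by apply: cf; exact: open_nbhs_nbhs.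
Qed.

Lemma closed_fiber x : closed [set y | f y = x].
Proof.
have -> : [set y | f y = x] = f @^-1` [set x] by [].
apply: preimage_closed; first by move=> y _; exact: cf.
by apply: accessible_closed_set1; exact: hausdorff_accessible.
Qed.

(** The complements of the closed sets mapped onto X satisfy the hypothesis of
    Zorn's lemma because the fibers of f are compact. *)
Lemma irreducible_core : exists Y1 : set Y,
  [/\ closed Y1, forall x, exists2 y, Y1 y & f y = x &
   forall K : set Y, closed K -> K `<=` Y1 ->
     (forall x, exists2 y, K y & f y = x) -> Y1 `<=` K].
Proof.
pose P : set (set Y) := fun W => open W /\ forall x, exists2 y, ~ W y & f y = x.
have [|W [[oW sW] Wmax]] := @Zorn_bigcup _ P.
  move=> F FP Ftot; split; first by apply: bigcup_open => W /FP[].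
  move=> x; have [->|F0] := eqVneq F set0.
    by have [y fy] := fY x; exists y => //; rewrite bigcup_set0.
  apply: contrapT => nx; have [|||||W FW KW] := @compact_chain_cover _ [set y | f y = x] F.
  - exact: subclosed_compact (@closed_fiber x) compact_cube _.
  - exact/set0P.
  - exact: Ftot.
  - by move=> W /FP[].
  - by move=> y fy; apply: contrapT => nF; apply: nx; exists y.
  - by have [_ /(_ x)[y nWy /KW]] := FP _ FW.
exists (~` W); split=> [|//|K cK KW sK]; first exact: open_closedC.
apply: contrapT => nWK; apply: (Wmax (~` K)).
  split=> [y Wy Ky|KW']; first exact: KW Ky Wy.
  by apply: nWK => y nWy; apply: contrapT => /KW'.
split; first exact: closed_openC.
by move=> x; have [y Ky fy] := sK x; exists y.
Qed.

Variable C : set (set X).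
Hypotheses (discC : forall E, C E -> discrete_set E) (infC : infinite_set C).
Hypothesis covC : forall x, exists2 E, C E & E x.

(** If f is constant on none of the smaller boxes, Zorn's lemma gives a maximal
    choice, for some members E of C, of finite sets of literals whose box has
    an image disjoint from those E.  Indexing the literals by the members of C
    already avoided bounds the number of literals.  A maximal choice treats
    every member E of C: if the image of the current box meets E in a point x, a
    neighbourhood of x isolates it in E; as f is not constant on a smaller box
    mapped into this neighbourhood, one can move away from x inside it.  Then no
    point of X is left for the image of the final box. *)
Lemma box_constant p : p #<= C -> box p !=set0 ->
  exists q, [/\ p `<=` q, q #<= C, box q !=set0 &
    forall y z, box q y -> box q z -> f y = f z].
Proof.
move=> pC p0; apply: contrapT => nq.
have ncst q : p `<=` q -> q #<= C -> box q !=set0 ->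
    forall x, exists2 y, box q y & f y <> x.
  move=> pq qC q0 x; apply: contrapT => H; apply: nq; exists q; split=> // y z qy qz.
  have fx u : box q u -> f u = x.
    by move=> qu; apply: contrapT => nu; apply: H; exists u.
  by rewrite !fx.
(* An element (E, s) of G records the literals s that were added in order to
   avoid E. *)
pose lits (G : set (set X * seq Lit)) := p `|` [set l | exists E s, G (E, s) /\ l \in s].
pose P (G : set (set X * seq Lit)) :=
  [/\ forall E s, G (E, s) -> C E,
      forall E s s', G (E, s) -> G (E, s') -> s = s',
      consistent (lits G) &
      forall E s, G (E, s) -> forall y, box (lits G) y -> ~ E (f y)].
have litsS G H : G `<=` H -> lits G `<=` lits H.
  move=> GH l [pl|[E [s [/GH Hs ls]]]]; first by left.
  by right; exists E, s.
have litsC G : (forall E s, G (E, s) -> C E) ->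
    (forall E s s', G (E, s) -> G (E, s') -> s = s') -> lits G #<= C.
  move=> GC Gf; apply: card_le_setU => //.
  have -> : [set l | exists E s, G (E, s) /\ l \in s] =
     \bigcup_(Es in G) [set` Es.2].
    apply/seteqP; split=> [l [E [s [Gs ls]]]|l [[E s] /= Gs ls]].
      by exists (E, s).
    by exists E, s.
  apply: card_le_bigcup => // [|Es _]; last first.
    exact/card_le_countable/finite_set_countable/finite_seq.
  apply: (@code_card_le _ _ _ _ (fun Es E => Es.1 = E)).
    by move=> [E s] /GC CE; exists E.
  by move=> [E s] [E' s'] E0 /= GE GE' eE eE'; move: GE GE';
    rewrite eE eE' => GE GE'; rewrite (Gf _ _ _ GE GE').
have [|G [PG Gmax]] := @Zorn_bigcup _ P.
  move=> F FP Ftot.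
  have join (u v : set X * seq Lit) : (\bigcup_(G in F) G) u -> (\bigcup_(G in F) G) v ->
      exists G, [/\ F G, G u & G v].
    move=> [G FG Gu] [H FH Hv].
    by case: (Ftot _ _ FG FH) => S; [exists H|exists G]; split=> //; exact: S.
  have joinl l l' : lits (\bigcup_(G in F) G) l -> lits (\bigcup_(G in F) G) l' ->
      (p l /\ p l') \/ exists G, [/\ F G, lits G l & lits G l'].
    move=> [pl|[E [s [Fs ls]]]] [pl'|[E' [s' [Fs' ls']]]].
    - by left.
    - by right; case: Fs' => G FG Gs; exists G; split=> //; [left|right; exists E', s'].
    - by right; case: Fs => G FG Gs; exists G; split=> //; [right; exists E, s|left].
    - right; have [G [FG Gs Gs']] := join _ _ Fs Fs'.
      by exists G; split=> //; right; [exists E, s|exists E', s'].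
  split.
  - by move=> E s [G /FP[+ _ _ _]]; exact.
  - move=> E s s' Fs Fs'; have [G [FG Gs Gs']] := join _ _ Fs Fs'.
    by have [_ + _ _] := FP _ FG; apply; eassumption.
  - have [pc1 pc2] := box_consistent p0.
    split=> [i d d' ql ql'|i d ql ql'].
      have [[]|[G [FG Gl Gl']]] := joinl _ _ ql ql'; first exact: pc1.
      by have [_ _ [+ _] _] := FP _ FG; apply; eassumption.
    have [[]|[G [FG Gl Gl']]] := joinl _ _ ql ql'; first exact: pc2.
    by have [_ _ [_ +] _] := FP _ FG; apply; eassumption.
  - move=> E s [G FG Gs] y By; have [_ _ _ H] := FP _ FG.
    by apply: (H _ _ Gs); apply: sub_box By; apply: litsS => ? ?; exists G.
have [GC Gf Gc Gm] := PG.
(* Some member of C is not yet treated: the one that contains f z. *)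
have [z Gz _] := consistent_pt Gc.
have [E0 CE0 E0z] := covC (f z).
have [E [CE nE]] : exists E, C E /\ forall s, ~ G (E, s).
  by exists E0; split=> // s Gs; apply: (Gm _ _ Gs z).
have [s [y sy sE]] : exists s, exists2 y, box (lits G `|` [set` s]) y &
    forall z, box (lits G `|` [set` s]) z -> ~ E (f z).
  have [[y Gy Ey]|nEy] := pselect (exists2 y, box (lits G) y & E (f y)); last first.
    exists [::], z => [|u]; first by move=> l [/Gz|].
    by rewrite boxU => -[Gu _] Eu; apply: nEy; exists u.
  (* [s1] leads into a set meeting E in f y only, [s2] away from f y. *)
  have [U [oU Uy yU]] := discrete_set_isolated (discC CE) Ey.
  have [s1 [s1y s1U]] := open_box_image oU Uy.
  have [|||y' qy' nyy'] := ncst (lits G `|` [set` s1]) _ _ _ (f y).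
  - by move=> l pl; left; left.
  - apply: card_le_setU => //; first exact: litsC.
    exact/card_le_countable/finite_set_countable/finite_seq.
  - by exists y; rewrite boxU.
  have [Gy' s1y'] : box (lits G) y' /\ box [set` s1] y' by move: qy'; rewrite boxU.
  have oV : open (U `&` ~` [set f y]).
    apply: openI => //; apply: closed_openC; apply: accessible_closed_set1.
    exact: hausdorff_accessible.
  have [|s2 [s2y s2U]] := open_box_image (y := y') oV.
    by split; [exact: s1U|].
  exists s2, y'; first by rewrite boxU.
  by move=> u; rewrite boxU => -[_ /s2U[Uu nu]] /(yU _ Uu).
pose H := G `|` [set (E, s)].
have lH : lits H = lits G `|` [set` s].
  apply/seteqP; split=> [l [pl|[E' [s' [[Gs|[_ ->]] ls]]]]|l [Gl|ls]].
  - by left; left.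
  - by left; right; exists E', s'.
  - by right.
  - by apply: litsS Gl => u; left.
  - by right; exists E, s; split=> //; right.
apply: (Gmax H); last split.
- split=> [u|HG]; first by left.
  by apply: (nE s); apply: HG; right.
- by move=> E' s' [/GC|[-> _]].
- move=> E' s1 s2 [Gs1|[e1 ->]] [Gs2|[e2 ->]] //.
  + exact: Gf Gs1 Gs2.
  + by case: (nE s1); rewrite -e2.
  + by case: (nE s2); rewrite -e1.
- by apply: box_consistent; exists y; rewrite lH.
- move=> E' s' Hs' u; rewrite lH => Bu.
  case: Hs' => [Gs'|[-> _]]; last exact: sE.
  by apply: (Gm _ _ Gs'); move: Bu; rewrite boxU => -[].
Qed.

(** A choice, for each x, of a member of C containing x and of an open set that
    isolates x in it. *)
Lemma isolating_nbhs : exists (E U : X -> set X), forall x,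
  [/\ C (E x), E x x, open (U x), U x x & forall w, U x w -> E x w -> w = x].
Proof.
have /choice[EU EUP] : forall x, exists EU : set X * set X,
    [/\ C EU.1, EU.1 x, open EU.2, EU.2 x & forall w, EU.2 w -> EU.1 w -> w = x].
  move=> x; have [E CE Ex] := covC x.
  by have [U [oU Ux Uy]] := discrete_set_isolated (discC CE) Ex; exists (E, U).
by exists (fun x => (EU x).1), (fun x => (EU x).2).
Qed.

Variable Y1 : set Y.
Hypotheses (cY1 : closed Y1) (sY1 : forall x, exists2 y, Y1 y & f y = x).
Hypothesis minY1 : forall K : set Y, closed K -> K `<=` Y1 ->
  (forall x, exists2 y, K y & f y = x) -> Y1 `<=` K.

Definition values (U : set X) (i : I) : set D :=
  [set d | exists y, [/\ Y1 y, U (f y) & y i = Some d]].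

(** The points of X all of whose preimages in Y1 lie in W.  By irreducibility
    it is a nonempty open set as soon as W is open and meets Y1, and disjoint
    sets W give disjoint sets of such points. *)
Definition covered_only (W : set Y) : set X := ~` (f @` (Y1 `\` W)).

Lemma covered_onlyP (W : set Y) x : covered_only W x <->
  forall y, Y1 y -> f y = x -> W y.
Proof.
split=> [nx y Yy fy|H [y [Yy nW] fy]]; last by apply: nW; exact: H.
by apply: contrapT => nW; apply: nx; exists y.
Qed.

Lemma open_covered_only (W : set Y) : open W -> open (covered_only W).
Proof.
move=> oW; apply: closed_openC; apply: closed_image => //.
by rewrite setDE; apply: closedI => //; exact: open_closedC.
Qed.

Lemma covered_only_nonempty (W : set Y) : open W -> W `&` Y1 !=set0 ->
  covered_only W !=set0.
Proof.
move=> oW [y [Wy Yy]]; apply: contrapT => nc.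
have [] : (Y1 `\` W) y; last by [].
apply: minY1 => //.
- by rewrite setDE; apply: closedI => //; exact: open_closedC.
- by move=> x; apply: contrapT => nx; apply: nc; exists x => -[z YWz fz]; apply: nx; exists z.
Qed.

(** Some coordinate i takes more than |C| values over the open set of points
    covered only by the box of s.  Prescribing such a value d gives disjoint
    open sets for distinct d, so one of them misses Q; a finite box around a
    point of Y1 above it does the job. *)
Lemma box_avoid (s : seq Lit) (Q : set X) :
  (forall U, open U -> U !=set0 -> exists i, ~ (values U i #<= C)) ->
  Q #<= C -> box [set` s] `&` Y1 !=set0 ->
  exists t, box [set` s ++ t] `&` Y1 !=set0 /\
    forall y, box [set` s ++ t] y -> ~ Q (f y).
Proof.
move=> big QC sY.
have [i ni] := big _ (open_covered_only (open_box s)) (covered_only_nonempty (open_box s) sY).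
pose W d := box [set` (i, d, true) :: s] : set Y.
have WE d y : W d y <-> y i = Some d /\ box [set` s] y.
  split=> [Wy|[yi sy] l].
    split; first by apply/sat_true; apply: Wy; rewrite /= mem_head.
    by move=> l ls; apply: Wy; rewrite /= in_cons (_ : l \in s) ?orbT.
  by rewrite /= in_cons => /orP[/eqP->|/sy//]; apply/sat_true.
have [d [vd dQ]] : exists d, values (covered_only (box [set` s])) i d /\
    forall x, covered_only (W d) x -> ~ Q x.
  apply: contrapT => nd; apply: ni; apply: (card_le_trans _ QC).
  apply: (@code_card_le _ _ _ _ (fun d x => covered_only (W d) x)).
    move=> d vd; apply: contrapT => nx; apply: nd; exists d; split=> // x Wx Qx.
    by apply: nx; exists x.
  move=> d d' x _ _ /covered_onlyP Wd /covered_onlyP Wd'.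
  have [y Yy fy] := sY1 x.
  have /WE[+ _] := Wd y Yy fy; have /WE[+ _] := Wd' y Yy fy.
  by move=> -> [].
have oW : open (W d) by exact: open_box.
have [|x Wx] := covered_only_nonempty oW.
  have [y [Yy /covered_onlyP cy yd]] := vd; exists y; split=> //.
  by apply/WE; split=> //; exact: cy.
have [y Yy fy] := sY1 x.
have Wy : W d y by have /covered_onlyP := Wx; apply.
have [|t [ty tW]] := open_box_image (y := y) (open_covered_only oW).
  by rewrite fy.
have [_ sy] := (WE d y).1 Wy.
exists t; split.
  by exists y; split=> // l; rewrite /= mem_cat => /orP[/sy|/ty].
move=> z stz; apply: dQ; apply: tW => l lt.
by apply: stz; rewrite /= mem_cat (_ : l \in t) ?orbT.
Qed.

Variables E U : X -> set X.
Hypothesis EU : forall x,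
  [/\ C (E x), E x x, open (U x), U x x & forall w, U x w -> E x w -> w = x].

(** The points to be avoided once the literals of s have been decided in the
    game of [exists_few_values].  The finite set t of literals describes a box
    around z that isolates x in its member of the cover; only its negative
    literals are imposed in addition to the positive ones of s, and countability
    of the support of z is what keeps these points few ([card_le_stuck]). *)
Definition stuck s : set X := [set x | exists z (t : seq Lit),
  [/\ f z = x, countable [set a : I * D | z a.1 = Some a.2],
      box [set l | l \in s /\ l.2] z, box [set` t] z &
      forall y, box [set l | l \in s /\ l.2] y ->
        box [set l | l \in t /\ ~~ l.2] y -> U x (f y)]].

(** Each stuck x comes with a support, a countable set of pairs (i, d), and with
    a finite set of excluded pairs disjoint from it.  If x and x' are stuck in
    the same member of C, then x = x' as soon as the support of x' avoids the
    pairs excluded by x.  Close off a set T of pairs under an operation that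
    sends a member E of C and a finite sequence a to the support of a stuck
    point r of E whose support avoids a, if there is one.  For x in E let a
    consist of the excluded pairs of x that lie in T.  Then x itself qualifies,
    so r exists; its support lies in T and avoids a, hence avoids all pairs
    excluded by x, and r = x.  So x is determined by E and a. *)
Lemma card_le_stuck s : stuck s #<= C.
Proof.
have [z0 _] : exists z : Y, True by exists (fun=> None).
have /choice[zt ztP] : forall x, exists zt : Y * seq Lit, stuck s x ->
   [/\ f zt.1 = x, countable [set a : I * D | zt.1 a.1 = Some a.2],
      box [set l | l \in s /\ l.2] zt.1, box [set` zt.2] zt.1 &
      forall y, box [set l | l \in s /\ l.2] y ->
        box [set l | l \in zt.2 /\ ~~ l.2] y -> U x (f y)].
  move=> x; have [[z [t zt]]|nx] := pselect (stuck s x); first by exists (z, t).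
  by exists (z0, [::]).
(* [good A a x]: the point x is stuck, belongs to the chosen member A of the
   cover, and has a support avoiding the pairs in a. *)
pose good (A : set X) (a : seq (I * D)) x :=
  [/\ stuck s x, E x = A & forall b, b \in a -> (zt x).1 b.1 <> Some b.2].
have /choice[r rP] : forall Aa : set X * seq (I * D), exists x,
    (exists x', good Aa.1 Aa.2 x') -> good Aa.1 Aa.2 x.
  move=> Aa; have [[x gx]|nx] := pselect (exists x, good Aa.1 Aa.2 x).
    by exists x.
  by exists (f z0).
pose h A a := [set b : I * D | good A a (r (A, a)) /\ (zt (r (A, a))).1 b.1 = Some b.2].
have [||T [TC Th]] := @card_le_closure _ C infC _ _ C h; first exact: card_lexx.
  move=> A a CA; apply: card_le_countable => //.
  have [g|ng] := pselect (good A a (r (A, a))).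
    have [/ztP[_ cz _ _ _] _ _] := g.
    by apply: sub_countable cz; apply: subset_card_le => b [].
  by apply: (sub_countable _ (countable0 nat)); apply/card_le0P; apply/seteqP; split=> // b [].
(* The pairs excluded by x that lie in the closed off set T. *)
pose code x := [seq l.1 | l <- (zt x).2 & ~~ l.2 && `[< T l.1 >]].
have goodx x : stuck s x -> good (E x) (code x) x.
  move=> sx; split=> // b /mapP[[[i d] e]]; rewrite mem_filter /=.
  move=> /andP[/andP[ne _] lt] ->; have [_ _ _ /(_ _ lt) + _] := ztP _ sx.
  by case: e ne lt => // _ _ /sat_false.
have rx x : stuck s x -> r (E x, code x) = x.
  move=> sx; have [CE _ _ _ UE] := EU x.
  have gr : good (E x) (code x) (r (E x, code x)).
    by apply: (rP (E x, code x)); exists x; exact: goodx.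
  have [sr Er ar] := gr; have [fzr _ szr _ _] := ztP _ sr.
  have Er' : E x (r (E x, code x)) by rewrite -[X in X _]Er; case: (EU (r (E x, code x))).
  apply: UE => //.
  rewrite -fzr; have [_ _ _ _] := ztP _ sx; apply=> // -[[i d] e] [/= lt ne].
  move: ne lt; case: e => // _ lt; apply/sat_false => zid.
  have Tid : T (i, d).
    apply: (Th (E x) (code x)) => // b /mapP[l]; rewrite mem_filter.
    by move=> /andP[/andP[_ /asboolP Tl] _] ->.
  apply: (ar (i, d)) => //; apply/mapP; exists (i, d, false) => //.
  by rewrite mem_filter lt /= andbT; apply/asboolP.
have CT : C `*` [set a : seq (I * D) | forall b, b \in a -> T b] #<= C.
  by apply: card_le_setX => //; exact: card_le_seq.
apply: card_le_trans CT.
apply: (@code_card_le _ _ _ _ (fun x Aa => Aa = (E x, code x))).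
  move=> x sx; exists (E x, code x) => //; split=> /=; first by case: (EU x).
  by move=> b /mapP[l]; rewrite mem_filter => /andP[/andP[_ /asboolP Tl] _] ->.
by move=> x x' _ /rx e /rx e' -> xx'; rewrite -e -e' xx'.
Qed.

(** Otherwise the game of [box_avoid] against the stuck points can be played
    for omega rounds, and the limit point z contradicts the definition of
    stuck. *)
Lemma exists_few_values :
  exists V, [/\ open V, V !=set0 & forall i, values V i #<= C].
Proof.
apply: contrapT => nV.
have big V : open V -> V !=set0 -> exists i, ~ (values V i #<= C).
  move=> oV V0; apply: contrapT => ni; apply: nV; exists V; split=> // i.
  by apply: contrapT => nc; apply: ni; exists i.
have /choice[g gP] : forall s, exists t, box [set` s] `&` Y1 !=set0 ->
    box [set` s ++ t] `&` Y1 !=set0 /\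
    forall y, box [set` s ++ t] y -> ~ stuck s (f y).
  move=> s; have [sY|nsY] := pselect (box [set` s] `&` Y1 !=set0).
    by have [t tP] := box_avoid big (card_le_stuck s) sY; exists t.
  by exists [::].
(* One run of the game, each round avoiding the points stuck at its beginning. *)
pose sq n := iter n (fun s => s ++ g s) [::].
have sqY n : box [set` sq n] `&` Y1 !=set0.
  elim: n => [|n IHn]; last by case: (gP _ IHn).
  by have [y Yy _] := sY1 (f (fun=> None)); exists y; split.
have sqle m n : (m <= n)%N -> {subset sq m <= sq n}.
  elim: n => [|n IHn]; first by rewrite leqn0 => /eqP->.
  rewrite leq_eqVlt => /orP[/eqP->//|]; rewrite ltnS => /IHn mn l /mn ls.
  by rewrite /= mem_cat ls.
pose q : set Lit := \bigcup_n [set` sq n].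
have qc : consistent q.
  have H l l' : q l -> q l' -> exists n, l \in sq n /\ l' \in sq n.
    move=> [m _ lm] [n _ ln]; exists (maxn m n); split.
      exact: sqle (leq_maxl _ _) _ lm.
    exact: sqle (leq_maxr _ _) _ ln.
  have sc n : consistent [set` sq n].
    by have [y [sy _]] := sqY n; apply: box_consistent; exists y.
  split=> [i d d' ql ql'|i d ql ql']; have [n [ln ln']] := H _ _ ql ql'.
    exact: (sc n).1 ln ln'.
  exact: (sc n).2 ln ln'.
have [z qz zq] := consistent_pt qc.
have sqz n : box [set` sq n] z by apply: sub_box qz => l ln; exists n.
have [_ _ oU Uz _] := EU (f z).
have [t [tz tU]] := open_box_image oU Uz.
have [n tn] : exists n, forall l, l \in t -> l.2 -> l \in sq n.
  elim: t tz {tU} => [|l t IHt] tz; first by exists 0.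
  have [|n tn] := IHt; first by apply: sub_box tz => l' /= lt; rewrite in_cons lt orbT.
  have [m lm] : exists m, l.2 -> l \in sq m.
    have := tz l (mem_head _ _); case: l {tz} => [[i d] [|]] zl; last by exists 0.
    by have [m _ lm] := zq _ _ ((sat_true _ _ _).1 zl); exists m.
  exists (maxn m n) => l'; rewrite in_cons => /orP[/eqP->|l't] l'2.
    exact: sqle (leq_maxl _ _) _ (lm l'2).
  exact: sqle (leq_maxr _ _) _ (tn _ l't l'2).
(* Round n decided all positive literals of [t], yet f z survived it. *)
have [_ /(_ z)] := gP _ (sqY n); case; first exact: (sqz n.+1).
exists z, t; split=> //.
- apply: (@sub_countable _ _ _ q); last first.
    by apply: bigcup_countable => // m _; exact/finite_set_countable/finite_seq.
  apply: (@code_card_le _ _ _ _ (fun a l => l = (a, true))).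
    by move=> [i d] /zq qid; exists (i, d, true).
  by move=> a b l _ _ -> [].
- by apply: sub_box (sqz n) => l [].
- move=> y sy ty; apply: tU => l lt; case l2 : (l.2).
    by apply: sy; split=> //; exact: tn.
  by apply: ty; split=> //; rewrite l2.
Qed.

(** The closed off set S of literals is also closed under change of sign, so
    that the box of constancy q of the S-part of a finite box t never conflicts
    with the literals of t outside S: a negative one excludes a value that q
    does not prescribe, and a positive one concerns a coordinate that does not
    occur in S, because S contains all values that its coordinates take over
    V. *)
Lemma card_le_few_values (V : set X) : open V ->
  (forall i, values V i #<= C) -> V #<= C.
Proof.
move=> oV vC.
have /choice[q qP] : forall s, exists q : set Lit, box [set` s] !=set0 ->
    [/\ [set` s] `<=` q, q #<= C, box q !=set0 &
        forall y z, box q y -> box q z -> f y = f z].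
  move=> s; have [s0|ns0] := pselect (box [set` s] !=set0); last by exists set0.
  have [|q qP] := box_constant _ s0; last by exists q.
  exact/card_le_countable/finite_set_countable/finite_seq.
(* Besides constancy boxes, the operation adds to each literal its opposite and
   all literals with the same coordinate and a value taken over V. *)
pose nb s := [set l : Lit | exists2 l', l' \in s &
  l.1.1 = l'.1.1 /\ (l.1 = l'.1 \/ values V l'.1.1 l.1.2)].
pose h (_ : unit) s := [set l | box [set` s] !=set0 /\ q s l] `|` nb s.
have [||S [SC Sh]] := @card_le_closure _ C infC _ _ [set: unit] h.
- exact/card_le_countable.
- move=> [] s _; apply: card_le_setU => //.
    have [s0|ns0] := pselect (box [set` s] !=set0).
      have [_ qC _ _] := qP _ s0; apply: card_le_trans qC.
      by apply: subset_card_le => l [].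
    rewrite (_ : [set l | _] = set0); first exact: card_ge0.
    by apply/seteqP; split=> // l [].
  apply: (@card_le_trans _ _ _ (\bigcup_(l' in [set` s])
     (([set l'.1.1] `*` ([set l'.1.2] `|` values V l'.1.1)) `*` [set: bool]))).
    apply: subset_card_le => -[[i d] e] [[[i' d'] e'] l's [/= -> H]].
    exists (i', d', e') => //; split=> //; split=> //=.
    by case: H => [/(congr1 snd)/= ->|vd]; [left|right].
  apply: card_le_bigcup => // [|l _].
    exact/card_le_countable/finite_set_countable/finite_seq.
  apply: card_le_setX => //; last exact: card_le_countable.
  by apply: card_le_setX => //; [|apply: card_le_setU => //];
    exact/card_le_countable/countable1.
have Snb l l' : S l' -> l.1.1 = l'.1.1 ->
    l.1 = l'.1 \/ values V l'.1.1 l.1.2 -> S l.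
  move=> Sl' e H; apply: (Sh tt [:: l']) => //; first by move=> ?; rewrite inE => /eqP->.
  by right; exists l' => //; rewrite mem_head.
(* The subcube supported by S. *)
pose YS : set Y := [set y | forall i d, y i = Some d -> S (i, d, true)].
have cYS : closed YS.
  have -> : YS = box [set l | ~~ l.2 /\ ~ S (l.1, true)].
    apply/seteqP; split=> [y YSy [[i d] [|]] [//= _ nS]|y By i d yid].
      by apply/sat_false => /YSy.
    apply: contrapT => nS; have /sat_false : sat y (i, d, false) by exact: By.
    by apply.
  exact: closed_box.
have VYS : V `<=` f @` YS.
  move=> x Vx; apply: contrapT => nx.
  have [y Yy fy] := sY1 x.
  have oW : open (V `&` ~` (f @` YS)).
    by apply: openI => //; apply: closed_openC; exact: closed_image.
  have [|t [ty tW]] := open_box_image (y := y) oW; first by rewrite fy.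
  pose s := [seq l <- t | `[< S l >]].
  have s0 : box [set` s] !=set0.
    by exists y; apply: sub_box ty => l; rewrite /= mem_filter => /andP[].
  have [sq qC q0 qf] := qP _ s0.
  have qS : q s `<=` S.
    move=> l ql; apply: (Sh tt s) => //; last by left.
    by move=> l'; rewrite mem_filter => /andP[/asboolP].
  have [z qz zq] := consistent_pt (box_consistent q0).
  (* [z] lies in the subcube; [u] follows it on the coordinates occurring in S
     and the preimage [y] of [x] elsewhere.  It lies both in the box of constancy
     and in the box of [t], whose image should miss that of the subcube. *)
  have /choice[u uP] : forall i, exists o : opc,
      ((exists d e, S (i, d, e)) -> o = z i) /\ (~ (exists d e, S (i, d, e)) -> o = y i).
    move=> i; have [H|H] := pselect (exists d e, S (i, d, e)).
      by exists (z i).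
    by exists (y i).
  have tu : box [set` t] u.
    move=> [[i d] e] lt; have [Si|nSi] := pselect (exists d e, S (i, d, e)); last first.
      by have := ty _ lt; rewrite /sat /= (uP i).2.
    rewrite /sat /= (uP i).1 // -/(sat z (i, d, e)).
    have [Sl|nSl] := pselect (S (i, d, e)).
      apply: qz; apply: sq; rewrite /= mem_filter lt andbT; exact/asboolP.
    have [d' [e' Sl']] := Si.
    case: e lt nSl => lt nSl.
      case: nSl; apply: (Snb _ _ Sl') => //=; right.
      exists y; split=> //; first by rewrite fy.
      by have /sat_true := ty _ lt.
    apply/sat_false => /zq/qS Sid; apply: nSl.
    by apply: (Snb _ _ Sid) => //=; left.
  have qu : box (q s) u.
    move=> [[i d] e] ql; have := qz _ ql; rewrite /sat /= (uP i).1 //.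
    by exists d, e; exact: qS.
  have [_] := tW _ tu; apply; exists z; last exact: qf.
  by move=> i d /zq/qS.
have /choice[zt ztP] : forall x, exists zt : Y * seq Lit, V x ->
    [/\ f zt.1 = x, YS zt.1, box [set` zt.2] zt.1 &
        forall y, box [set` zt.2] y -> U x (f y)].
  move=> x; have [Vx|nVx] := pselect (V x); last by exists (fun=> None, [::]).
  have [z YSz fz] := VYS _ Vx; have [_ _ oU Ux _] := EU x.
  have [|t [tz tU]] := open_box_image (y := z) oU; first by rewrite fz.
  by exists (z, t).
pose code x := [seq l <- (zt x).2 | `[< S l >]].
have CS : C `*` [set s : seq Lit | forall l, l \in s -> S l] #<= C.
  by apply: card_le_setX => //; exact: card_le_seq.
apply: card_le_trans CS.
apply: (@code_card_le _ _ _ _ (fun x Aa => Aa = (E x, code x))).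
  move=> x Vx; exists (E x, code x) => //; split=> /=; first by case: (EU x).
  by move=> l; rewrite mem_filter => /andP[/asboolP].
move=> x x' _ Vx Vx' -> [eE ec].
have [_ _ _ _ UE] := EU x; apply/esym/UE; last by rewrite eE; case: (EU x').
have [fz' YSz' tz' _] := ztP _ Vx'; have [_ YSz tz tU] := ztP _ Vx.
rewrite -fz'; apply: tU => -[[i d] e] lt.
have [Sl|nSl] := pselect (S (i, d, e)).
  have : (i, d, e) \in code x by rewrite mem_filter lt andbT; exact/asboolP.
  by rewrite ec mem_filter => /andP[_]; exact: tz'.
have nS e' : ~ S (i, d, e') by move=> Se'; apply: nSl; apply: (Snb _ _ Se') => //; left.
have := tz _ lt; case: e lt {nSl} => lt.
  by move=> /sat_true /YSz /nS.
by move=> _; apply/sat_false => /YSz' /nS.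
Qed.

End Image.

(** * Discrete covers of crowded spaces *)

(** Around a point of E, remove that point from a neighbourhood isolating it in
    E: something remains because no point is open. *)
Lemma discrete_nowhere_dense (X : topologicalType) (E V : set X) :
  hausdorff_space X -> (forall x : X, ~ open [set x]) -> discrete_set E ->
  open V -> V !=set0 -> exists W, [/\ open W, W !=set0, W `<=` V & W `&` E = set0].
Proof.
move=> hX crowded dE oV V0.
have [[x Vx Ex]|nE] := pselect (exists2 x, V x & E x); last first.
  exists V; split=> //; apply/seteqP; split=> // x [Vx Ex].
  by apply: nE; exists x.
have [U [oU Ux UE]] := discrete_set_isolated dE Ex.
have oW : open (V `&` U `&` ~` [set x]).
  apply: openI; first exact: openI.
  by apply: closed_openC; apply: accessible_closed_set1; exact: hausdorff_accessible.
exists (V `&` U `&` ~` [set x]); split=> //.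
- apply: contrapT => W0; apply: (crowded x).
  suff <- : V `&` U = [set x] by exact: openI.
  apply/seteqP; split=> [y VUy|_ ->//]; apply: contrapT => nyx.
  by apply: W0; exists y.
- by move=> y [[]].
- by apply/seteqP; split=> // y [[[_ Uy] nyx] Ey]; apply: nyx; exact: UE.
Qed.

Lemma crowded_discrete_cover_infinite (X : topologicalType) (C : set (set X)) :
  hausdorff_space X -> [set: X] !=set0 -> (forall x : X, ~ open [set x]) ->
  discrete_cover C -> infinite_set C.
Proof.
move=> hX X0 crowded [dC cC] /finite_seqP[s sC].
have dE (E : set X) : E \in s -> discrete_set E by move=> Es; apply: dC; rewrite sC.
have [V [_ [x Vx] VE]] : exists V : set X,
    [/\ open V, V !=set0 & forall E : set X, E \in s -> V `&` E = set0].
  elim: s dE {sC} => [|E s IHs] dE; first by exists setT; split=> //; exact: openT.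
  have [|V [oV V0 Vs]] := IHs.
    by move=> F Fs; apply: dE; rewrite in_cons Fs orbT.
  have [|W [oW W0 WV WE]] := @discrete_nowhere_dense _ E V hX crowded _ oV V0.
    by apply: dE; exact: mem_head.
  exists W; split=> // F; rewrite in_cons => /orP[/eqP->//|/Vs VF].
  by apply/seteqP; split=> // x [/WV Vx Fx]; rewrite -VF.
have : (\bigcup_(E in C) E) x by rewrite cC.
move=> [E CE Ex]; have Es : E \in s by move: CE; rewrite sC.
by have : (V `&` E) x by []; rewrite VE.
Qed.

Unset Implicit Arguments.
Set Strict Implicit.

Theorem theorem2p13 (X : topologicalType) (hX : polyadic X) :
  dis X #>= Delta X.
Proof.
have X0 := polyadic_nonempty hX; have [_ _ Dmin] := DeltaP X0.
have [[discC bigC] _] := disP X.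
suff [V [oV V0 VC]] : exists V : set X, [/\ open V, V !=set0 & V #<= dis X].
  exact: card_le_trans (Dmin _ oV V0) VC.
have covC (x : X) : exists2 E, dis X E & E x.
  by have : [set: X] x by []; rewrite -bigC => -[E]; exists E.
have [[x ox]|crowded] := pselect (exists x : X, open [set x]).
  exists [set x]; split=> //; first by exists x.
  have [E CE _] := covC x.
  by apply: (@code_card_le _ _ _ _ (fun _ _ => True)) => [_ _|_ _ _ -> ->//]; exists E.
have infC : infinite_set (dis X).
  by apply: crowded_discrete_cover_infinite => // [|x ox]; [case: hX|apply: crowded; exists x].
case: hX => _ hX [D [I [f [cf fT]]]]; elim/Peq: I => I in f cf fT.
have fY x : exists y, f y = x.
  have [y _ fy] : range f x by rewrite fT.
  by exists y.
have [Y1 [cY1 sY1 minY1]] := irreducible_core hX cf fY.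
have [E [U EU]] := isolating_nbhs discC covC.
have [V [oV V0 vV]] := exists_few_values hX cf infC cY1 sY1 minY1 EU.
exists V; split=> //.
exact: (card_le_few_values hX cf discC infC covC sY1 EU oV vV).
Qed.
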